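(* Suppose $(a_i)_{i=1}^n$, $(b_i)_{i=1}^n$, $(a'_i)_{i=1}^n$, $(b'_i)_{i=1}^n$ are sequences of complex numbers and $A, B, \epsilon$ are positive real numbers with $\epsilon < \min(1/A, 1/e)$, such that $\sum_{i=1}^n |a_i| e^{|b_i|} \le B$ and for all $i$: (1) $2|a_i| e^{|b_i|+1} \le A$; (2) $|b_i - b'_i| < \epsilon$; (3) $|a_i - a'_i| < \epsilon |a_i|$. Then $$\Big\| \prod_{i=1}^n Y(b_i) X(a_i) Y(-b_i) - \prod_{i=1}^n Y(b'_i) X(a'_i) Y(-b'_i) \Big\| \le 12\, e^{A+2B} B \epsilon.$$
   Context: For a matrix $U \in \mathfrak{sl}_2(\mathbb{C})$ and $t\in\mathbb{C}$, $U(t)$ denotes $\exp(tU)\in\mathrm{SL}_2(\mathbb{C})$. Let $X = \begin{pmatrix} 1/2 & 0 \\ 0 & -1/2 \end{pmatrix}$, $\theta = \begin{pmatrix} 0 & -1/2 \\ 1/2 & 0\end{pmatrix}$, and $Y = e^{(\pi/2)\mathrm{ad}_\theta} X = \theta(\pi/2) X \theta(-\pi/2)$. All matrices are regarded as elements of $M_2(\mathbb{C})$, and $\|\cdot\|$ is the operator norm with respect to the standard Hermitian ($L^2$) norm on $\mathbb{C}^2$. *)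

(* Defs.v *)
From HB Require Import structures.
From mathcomp Require Import all_boot all_order all_algebra.
From mathcomp Require Import complex.
From mathcomp Require Import all_classical all_reals all_analysis.
Set Implicit Arguments. Unset Strict Implicit. Unset Printing Implicit Defensive.
Import Order.TTheory GRing.Theory Num.Theory ComplexField numFieldNormedType.Exports.
Local Open Scope ring_scope.
Local Open Scope complex_scope.

Section Defs.
Variable R : realType.

Definition cabs (z : R[i]) : R := complex.Re `|z|.

Definition mexp_partial (M : 'M[R[i]]_2) (N : nat) : 'M[R[i]]_2 :=
  \sum_(k < N) ((k`!%:R)^-1 *: M ^+ k).

Definition mexp (M : 'M[R[i]]_2) : 'M[R[i]]_2 :=
  \matrix_(i, j)
    ((limn (fun N : nat => (complex.Re (mexp_partial M N i j) : R)))%:C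
     + 'i * (limn (fun N : nat => (complex.Im (mexp_partial M N i j) : R)))%:C).

Definition mflow (U : 'M[R[i]]_2) (t : R[i]) : 'M[R[i]]_2 := mexp (t *: U).

Definition Xm : 'M[R[i]]_2 :=
  \matrix_(i, j) (if (i == 0) && (j == 0) then (1/2)%:C
                  else if (i == 1) && (j == 1) then (-(1/2))%:C else 0).

Definition thetam : 'M[R[i]]_2 :=
  \matrix_(i, j) (if (i == 0) && (j == 1) then (-(1/2))%:C
                  else if (i == 1) && (j == 0) then (1/2)%:C else 0).

Definition Ym : 'M[R[i]]_2 :=
  mflow thetam (pi / 2)%:C *m Xm *m mflow thetam (- (pi / 2))%:C.

Definition hnorm (v : 'cV[R[i]]_2) : R :=
  Num.sqrt (\sum_(i < 2) (complex.Re (v i 0) ^+ 2 + complex.Im (v i 0) ^+ 2)).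

Definition opnorm (M : 'M[R[i]]_2) : R :=
  sup [set r : R | exists v : 'cV[R[i]]_2, hnorm v = 1 /\ r = hnorm (M *m v)].

End Defs.

(* Main.v *)
Require Import Defs.
From HB Require Import structures.
From mathcomp Require Import all_boot all_order all_algebra.
From mathcomp Require Import complex.
From mathcomp Require Import all_classical all_reals all_analysis.
From mathcomp Require Import ring lra.
Import Order.TTheory GRing.Theory Num.Theory ComplexField numFieldNormedType.Exports.
Local Open Scope ring_scope.
Local Open Scope classical_set_scope.
Local Open Scope complex_scope.
Set Implicit Arguments.
Unset Strict Implicit.

(* Conjugation gives [Y(b) X(a) Y(-b) = exp (a Z(b))] with [Z(b) = Y(b) X Y(-b)],
   so everything reduces to the Lipschitz estimate
   [|exp M - exp W| <= |M - W| exp (max |M| |W|)], applied once to [Y] and once to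
   [a Z(b)], followed by telescoping the products. The estimates are made in the
   maximal row sum norm: it is submultiplicative with [|1| = 1], gives [X] and
   [Y = ((0, 1/2), (1/2, 0))] norm [1/2] as the operator norm does, and dominates
   the operator norm up to a factor 2. With [m_i = |a_i| exp |b_i|] both exponents
   have norm at most [2 m_i] and differ by at most [2 eps m_i], which bounds the
   left-hand side by [4 exp (2 B) B eps]. *)

(** * The real-valued complex modulus *)

Section ComplexModulus.
Variable R : realType.
Implicit Types x y z : R[i].

Lemma cabsE z : cabs z = Normc.normc z.
Proof. by []. Qed.

Lemma sqr_cabs z : cabs z ^+ 2 = complex.Re z ^+ 2 + complex.Im z ^+ 2.
Proof. by rewrite cabsE; case: z => u v /=; rewrite sqr_sqrtr ?addr_ge0 ?sqr_ge0. Qed.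

Lemma cabs_ge0 z : 0 <= cabs z.
Proof. by rewrite cabsE; case: z => u v; exact: sqrtr_ge0. Qed.

Lemma cabs0 : cabs (0 : R[i]) = 0.
Proof. exact: Normc.normc0. Qed.

Lemma cabs1 : cabs (1 : R[i]) = 1.
Proof. exact: Normc.normc1. Qed.

Lemma cabsM x y : cabs (x * y) = cabs x * cabs y.
Proof. exact: Normc.normcM. Qed.

Lemma cabsN x : cabs (- x) = cabs x.
Proof. by rewrite /cabs normrN. Qed.

Lemma cabsD x y : cabs (x + y) <= cabs x + cabs y.
Proof. exact: le_normcD. Qed.

Lemma cabs0_eq0 x : cabs x = 0 -> x = 0.
Proof. exact: Normc.eq0_normc. Qed.

Lemma cabs_sum (I : Type) (r : seq I) (P : pred I) (F : I -> R[i]) :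
  cabs (\sum_(i <- r | P i) F i) <= \sum_(i <- r | P i) cabs (F i).
Proof.
elim/big_ind2 : _ => [|x u y v xu yv|//]; first by rewrite cabs0.
exact: le_trans (cabsD _ _) (lerD xu yv).
Qed.

Lemma cabs_real (r : R) : cabs r%:C = `|r|.
Proof. by rewrite cabsE /= expr0n addr0 sqrtr_sqr. Qed.

Lemma cabs_invfact k : cabs ((k`!%:R)^-1 : R[i]) = (k`!%:R)^-1.
Proof.
by rewrite -(rmorph_nat (real_complex R)) -fmorphV cabs_real ger0_norm.
Qed.

Lemma normr_Re_le z : `|complex.Re z| <= cabs z.
Proof.
rewrite -(@ler_pXn2r _ 2)// ?nnegrE ?cabs_ge0// sqr_cabs real_normK ?num_real//.
by rewrite lerDl sqr_ge0.
Qed.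

Lemma normr_Im_le z : `|complex.Im z| <= cabs z.
Proof.
rewrite -(@ler_pXn2r _ 2)// ?nnegrE ?cabs_ge0// sqr_cabs real_normK ?num_real//.
by rewrite lerDr sqr_ge0.
Qed.

Lemma cabs_le_ReIm z : cabs z <= `|complex.Re z| + `|complex.Im z|.
Proof.
rewrite -(@ler_pXn2r _ 2)// ?nnegrE ?cabs_ge0 ?addr_ge0// sqr_cabs sqrrD.
by rewrite !real_normK ?num_real// lerD2r lerDl mulrn_wge0 ?mulr_ge0.
Qed.

End ComplexModulus.

(** * The maximal row sum norm and its comparison with the operator norm *)

Section RowSumNorm.
Variable R : realType.
Local Notation M2 := 'M[R[i]]_2.
Implicit Types (M W : M2) (c : R).

Definition rownorm M : R := \big[Num.max/0]_i \sum_j cabs (M i j).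

Lemma rownorm_ge0 M : 0 <= rownorm M.
Proof. by apply: bigmax_ge_id. Qed.

Lemma rowsum_le M i : \sum_j cabs (M i j) <= rownorm M.
Proof. exact: (le_bigmax _ (fun i => \sum_j cabs (M i j))). Qed.

Lemma rownorm_le M c : 0 <= c -> (forall i, \sum_j cabs (M i j) <= c) ->
  rownorm M <= c.
Proof. by move=> c0 Mc; apply: bigmax_le. Qed.

Lemma entry_le_rownorm M i j : cabs (M i j) <= rownorm M.
Proof.
apply: le_trans (rowsum_le M i); rewrite (bigD1 j)//= lerDl.
by apply: sumr_ge0 => k _; exact: cabs_ge0.
Qed.

Lemma rownorm_eq0 M : rownorm M <= 0 -> M = 0.
Proof.
move=> M0; apply/matrixP => i j; rewrite mxE; apply: cabs0_eq0.
by apply/eqP; rewrite eq_le cabs_ge0 (le_trans (entry_le_rownorm M i j)).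
Qed.

Lemma rownorm0 : rownorm 0 = 0.
Proof.
apply/eqP; rewrite eq_le rownorm_ge0 andbT; apply: rownorm_le => // i.
by rewrite big1// => j _; rewrite mxE cabs0.
Qed.

Lemma rownorm1 : rownorm 1 <= 1.
Proof.
apply: rownorm_le => // i; rewrite (bigD1 i)//= mxE eqxx cabs1 big1 ?addr0//.
by move=> j; rewrite eq_sym => /negPf ij; rewrite mxE ij cabs0.
Qed.

Lemma rownormZ (z : R[i]) M : rownorm (z *: M) <= cabs z * rownorm M.
Proof.
apply: rownorm_le => [|i]; first by rewrite mulr_ge0 ?cabs_ge0 ?rownorm_ge0.
under eq_bigr do rewrite mxE cabsM.
by rewrite -mulr_sumr ler_wpM2l ?cabs_ge0 ?rowsum_le.
Qed.

Lemma rownormN M : rownorm (- M) = rownorm M.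
Proof.
by apply: eq_bigr => i _; apply: eq_bigr => j _; rewrite mxE cabsN.
Qed.

Lemma rownormD M W : rownorm (M + W) <= rownorm M + rownorm W.
Proof.
apply: rownorm_le => [|i]; first by rewrite addr_ge0 ?rownorm_ge0.
apply: le_trans (lerD (rowsum_le M i) (rowsum_le W i)).
by rewrite -big_split; apply: ler_sum => j _; rewrite mxE cabsD.
Qed.

Lemma rownormB M W : rownorm (M - W) <= rownorm M + rownorm W.
Proof. by rewrite -(rownormN W) rownormD. Qed.

Lemma rownormM M W : rownorm (M * W) <= rownorm M * rownorm W.
Proof.
apply: rownorm_le => [|i]; first by rewrite mulr_ge0 ?rownorm_ge0.
apply: (@le_trans _ _ (\sum_j \sum_k cabs (M i k) * cabs (W k j))).
  apply: ler_sum => j _; rewrite mxE; apply: le_trans (cabs_sum _ _ _) _.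
  by apply: ler_sum => k _; rewrite cabsM.
rewrite exchange_big /=.
apply: (@le_trans _ _ (\sum_k cabs (M i k) * rownorm W)).
  by apply: ler_sum => k _; rewrite -mulr_sumr ler_wpM2l ?cabs_ge0 ?rowsum_le.
by rewrite -mulr_suml ler_wpM2r ?rownorm_ge0 ?rowsum_le.
Qed.

Lemma rownormX M k : rownorm (M ^+ k) <= rownorm M ^+ k.
Proof.
elim: k => [|k IHk]; first by rewrite !expr0 rownorm1.
rewrite !exprS; apply: le_trans (rownormM _ _) _.
by rewrite ler_wpM2l ?rownorm_ge0.
Qed.

Lemma rownorm_sum (I : Type) (r : seq I) (P : pred I) (F : I -> M2) :
  rownorm (\sum_(i <- r | P i) F i) <= \sum_(i <- r | P i) rownorm (F i).
Proof.
elim/big_ind2 : _ => [|x u y v xu yv|//]; first by rewrite rownorm0.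
exact: le_trans (rownormD _ _) (lerD xu yv).
Qed.

(* Telescoping [M ^+ k.+1 - W ^+ k.+1 = (M - W) M ^+ k + W (M ^+ k - W ^+ k)]. *)
Lemma rownorm_subX M W c k : rownorm M <= c -> rownorm W <= c ->
  rownorm (M ^+ k.+1 - W ^+ k.+1) <= k.+1%:R * c ^+ k * rownorm (M - W).
Proof.
move=> Mc Wc; have c0 : 0 <= c by exact: le_trans (rownorm_ge0 _) Mc.
elim: k => [|k IHk]; first by rewrite !expr1 expr0 !mul1r.
have -> : M ^+ k.+2 - W ^+ k.+2 =
    (M - W) * M ^+ k.+1 + W * (M ^+ k.+1 - W ^+ k.+1).
  by rewrite !(exprS _ k.+1) mulrBl mulrBr addrA subrK.
apply: le_trans (rownormD _ _) _.
apply: le_trans (lerD (rownormM _ _) (rownormM _ _)) _.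
have -> : k.+2%:R * c ^+ k.+1 * rownorm (M - W) =
    rownorm (M - W) * c ^+ k.+1 + c * (k.+1%:R * c ^+ k * rownorm (M - W)).
  by rewrite -[in LHS]natr1 exprS; ring.
apply: lerD; last by apply: ler_pM; rewrite ?rownorm_ge0.
apply: ler_wpM2l; first exact: rownorm_ge0.
by apply: le_trans (rownormX _ _) _; rewrite lerXn2r ?nnegrE ?rownorm_ge0.
Qed.

Lemma rownorm_prod (I : Type) (r : seq I) (F : I -> M2) (c : I -> R) :
  (forall i, rownorm (F i) <= expR (c i)) ->
  rownorm (\prod_(i <- r) F i) <= expR (\sum_(i <- r) c i).
Proof.
move=> Fc; elim: r => [|i r IHr]; first by rewrite !big_nil expR0 rownorm1.
rewrite !big_cons expRD; apply: le_trans (rownormM _ _) _.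
by apply: ler_pM; rewrite ?rownorm_ge0.
Qed.

(** Telescoping, replacing one factor at a time. Each local error carries its own [expR (c i)], so
    every summand has the same total exponential, which factors out. *)
Lemma rownorm_subprod (I : Type) (r : seq I) (F G : I -> M2) (c d : I -> R) :
  (forall i, rownorm (F i) <= expR (c i)) ->
  (forall i, rownorm (G i) <= expR (c i)) ->
  (forall i, rownorm (F i - G i) <= d i * expR (c i)) ->
  rownorm (\prod_(i <- r) F i - \prod_(i <- r) G i)
    <= (\sum_(i <- r) d i) * expR (\sum_(i <- r) c i).
Proof.
move=> Fc Gc FGd; elim: r => [|i r IHr].
  by rewrite !big_nil subrr rownorm0 mul0r.
rewrite !big_cons; set P := \prod_(j <- r) F j; set Q := \prod_(j <- r) G j.
have -> : F i * P - G i * Q = (F i - G i) * P + G i * (P - Q).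
  by rewrite mulrBl mulrBr addrA subrK.
apply: le_trans (rownormD _ _) _.
apply: le_trans (lerD (rownormM _ _) (rownormM _ _)) _.
rewrite expRD mulrDl.
apply: lerD; first by rewrite mulrA; apply: ler_pM; rewrite ?rownorm_ge0 ?rownorm_prod.
by rewrite mulrCA; apply: ler_pM; rewrite ?rownorm_ge0.
Qed.

Lemma sqr_hnorm (v : 'cV[R[i]]_2) : hnorm v ^+ 2 = \sum_i cabs (v i 0) ^+ 2.
Proof.
rewrite /hnorm sqr_sqrtr; first by apply: eq_bigr => i _; rewrite sqr_cabs.
by apply: sumr_ge0 => i _; rewrite addr_ge0 ?sqr_ge0.
Qed.

(** For a unit vector [v] each [cabs (v j 0)] is at most 1, so both coordinates of [M *m v] are
    bounded by row sums. The squared norm is then at most [2 * rownorm M ^+ 2], which lies below the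
    square of [2 * rownorm M]. *)
Lemma opnorm_le_rownorm M : opnorm M <= 2 * rownorm M.
Proof.
apply: ge_sup.
  (* The set must be nonempty for [ge_sup]; the first basis vector supplies an element. *)
  exists (hnorm (M *m delta_mx 0 0)), (delta_mx 0 0); split=> //.
  rewrite /hnorm !big_ord_recl big_ord0 !mxE /= !expr0n /= expr1n.
  by rewrite !addr0 sqrtr1.
move=> _ [v [v1 ->]].
rewrite -(@ler_pXn2r _ 2)// ?nnegrE ?sqrtr_ge0 ?mulr_ge0 ?rownorm_ge0//.
rewrite sqr_hnorm.
apply: (@le_trans _ _ (\sum_(i < 2) rownorm M ^+ 2)); last first.
  rewrite sumr_const card_ord exprMn -[leLHS]mulr_natl ler_wpM2r ?sqr_ge0//.
  by rewrite -natrX ler_nat.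
apply: ler_sum => i _; rewrite lerXn2r ?nnegrE ?rownorm_ge0 ?cabs_ge0//.
rewrite mxE; apply: le_trans (cabs_sum _ _ _) (le_trans _ (rowsum_le M i)).
apply: ler_sum => j _; rewrite cabsM ler_piMr ?cabs_ge0//.
rewrite -(@ler_pXn2r _ 2)// ?nnegrE ?cabs_ge0// expr1n.
have := sqr_hnorm v; rewrite v1 expr1n => ->; rewrite (bigD1 j)//= lerDl.
by apply: sumr_ge0 => k _; exact: sqr_ge0.
Qed.

End RowSumNorm.

(** * Cauchy products of truncated exponential series *)

Section CauchyProduct.

(** The antidiagonals [i + j = k] with [k < n] fill the triangle [i + j < n]; regrouped by [j], they
    cut each column of the square at height [n - j]. *)
Lemma square_sub_triangle (V : zmodType) (f : nat -> nat -> V) (n : nat) :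
  \sum_(0 <= i < n) \sum_(0 <= j < n) f i j
    - \sum_(0 <= k < n) \sum_(0 <= j < k.+1) f (k - j)%N j
  = \sum_(0 <= j < n) \sum_(n - j <= i < n) f i j.
Proof.
have -> : \sum_(0 <= k < n) \sum_(0 <= j < k.+1) f (k - j)%N j =
    \sum_(0 <= j < n) \sum_(0 <= i < n - j) f i j.
  (* The new antidiagonal adds the cell [i = n - j] to each column [j < n] and opens column [n] with
     the cell [i = 0]. *)
  elim: n => [|n IHn]; first by rewrite !big_nil.
  rewrite big_nat_recr//= IHn [RHS]big_nat_recr//= subSnn big_nat1.
  rewrite [X in _ + X]big_nat_recr//= subnn addrA; congr (_ + _).
  rewrite -big_split /=; apply: eq_big_nat => j /andP[_ jn].
  by rewrite subSn 1?ltnW// big_nat_recr.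
rewrite exchange_big /= -sumrB; apply: eq_big_nat => j _.
by rewrite (@big_cat_nat _ _ _ (n - j)) ?leq_subr//= addrAC subrr add0r.
Qed.

(** Stated over any algebra, so that one identity serves both the matrices and, through [R^o], the
    real series at their norms. *)
Definition expsum (F : numFieldType) (A : algType F) (x : A) (n : nat) : A :=
  \sum_(k < n) (k`!%:R)^-1 *: x ^+ k.

(** By the binomial theorem [(x + y)^k / k!] is the sum of [x^i y^j / (i! j!)] over [i + j = k]. The
    defect is an exact sum with positive coefficients, hence comparable term by term with its real
    counterpart. *)
Lemma expsum_mul_sub (F : numFieldType) (A : algType F) (x y : A) (n : nat) :
  GRing.comm x y ->
  expsum x n * expsum y n - expsum (x + y) n
  = \sum_(0 <= j < n) \sum_(n - j <= i < n)
      ((i`!%:R)^-1 * (j`!%:R)^-1) *: (x ^+ i * y ^+ j).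
Proof.
move=> cxy; rewrite -square_sub_triangle; congr (_ - _).
  rewrite /expsum big_distrlr /= big_mkord; apply: eq_bigr => i _.
  rewrite big_mkord; apply: eq_bigr => j _.
  by rewrite -scalerAl -scalerAr scalerA.
rewrite /expsum big_mkord; apply: eq_bigr => k _.
rewrite exprDn_comm// scaler_sumr big_mkord; apply: eq_bigr => -[j jk] _ /=.
rewrite -[X in _ *: X]scaler_nat scalerA; congr (_ *: _).
have f0 m : (m`!%:R : F) != 0 by rewrite pnatr_eq0 -lt0n fact_gt0.
have := bin_fact (jk : (j <= k)%N) => /(congr1 (fun m => m%:R : F)).
rewrite !natrM => kE; rewrite -kE.
have C0 : ('C(k, j)%:R : F) != 0 by rewrite pnatr_eq0 -lt0n bin_gt0.
by field; rewrite !f0 C0.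
Qed.

End CauchyProduct.

(** * Limits of matrix sequences in the row sum norm *)

Section MatrixLimits.
Variable R : realType.
Local Notation M2 := 'M[R[i]]_2.
Implicit Types (M W L K V : M2) (u v : nat -> M2).

Definition mlim u L : Prop := rownorm (u n - L) @[n --> \oo] --> (0 : R).

Lemma mlim_squeeze u L (c : nat -> R) :
  (forall n, rownorm (u n - L) <= c n) -> c n @[n --> \oo] --> (0 : R) ->
  mlim u L.
Proof.
move=> uc c0; apply: (@squeeze_cvgr _ _ _ _ (fun=> 0) c) => //; last exact: cvg_cst.
by apply: nearW => n; rewrite rownorm_ge0 uc.
Qed.

(** Pass to the limit in [rownorm L <= rownorm (u n - L) + c n]. The bound may depend on [n], so
    that partial sums can be majorised by partial sums of a real series. *)
Lemma mlim_le u L (c : nat -> R) (l : R) :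
  mlim u L -> (forall n, rownorm (u n) <= c n) ->
  c n @[n --> \oo] --> l -> rownorm L <= l.
Proof.
move=> uL uc cl.
have h : rownorm (u n - L) + c n @[n --> \oo] --> 0 + l by exact: cvgD.
rewrite add0r in h.
apply: (ler_cvg_to (cvg_cst (rownorm L)) h); apply: nearW => n.
rewrite -[L in leLHS](subKr (u n)) [leRHS]addrC.
by apply: le_trans (rownormB _ _) _; rewrite lerD2r.
Qed.

Lemma mlim_cst L : mlim (fun=> L) L.
Proof. by rewrite /mlim subrr rownorm0; exact: cvg_cst. Qed.

Lemma mlim_unique u L K : mlim u L -> mlim u K -> L = K.
Proof.
move=> uL uK; apply/subr0_eq/rownorm_eq0.
apply: (mlim_le (mlim_cst (L - K))).
  move=> n; have -> : L - K = (u n - K) - (u n - L) by rewrite opprB [RHS]addrC addrA subrK.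
  exact: rownormB.
by rewrite -[X in _ --> X]addr0; exact: cvgD.
Qed.

Lemma mlimB u v L K : mlim u L -> mlim v K -> mlim (fun n => u n - v n) (L - K).
Proof.
move=> uL vK; apply: (@mlim_squeeze _ _ (fun n => rownorm (u n - L) + rownorm (v n - K))).
  move=> n; have -> : u n - v n - (L - K) = (u n - L) - (v n - K).
    by rewrite !opprD addrACA.
  exact: rownormB.
by rewrite -[X in _ --> X]addr0; exact: cvgD.
Qed.

Lemma mlimM u v L K : mlim u L -> mlim v K -> mlim (fun n => u n * v n) (L * K).
Proof.
move=> uL vK.
apply: (@mlim_squeeze _ _ (fun n => rownorm (u n - L) * (rownorm (v n - K) + rownorm K)
                          + rownorm L * rownorm (v n - K))).
  move=> n; have -> : u n * v n - L * K = (u n - L) * v n + L * (v n - K).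
    by rewrite mulrBl mulrBr addrA subrK.
  apply: le_trans (rownormD _ _) (lerD _ (rownormM _ _)).
  apply: le_trans (rownormM _ _) (ler_wpM2l (rownorm_ge0 _) _).
  by rewrite -[X in rownorm X <= _](subrK K); exact: rownormD.
have -> : 0 = 0 * (0 + rownorm K) + rownorm L * 0 :> R by rewrite mul0r mulr0 addr0.
apply: cvgD; first by apply: cvgM => //; apply: cvgD => //; exact: cvg_cst.
by apply: cvgM => //; exact: cvg_cst.
Qed.

(** The bridge to norm convergence from [mexp], which is defined by limits of the real and imaginary
    parts of entries. *)
Lemma mlim_entrywise u L :
  (forall i j, complex.Re (u n i j) @[n --> \oo] --> complex.Re (L i j)) ->
  (forall i j, complex.Im (u n i j) @[n --> \oo] --> complex.Im (L i j)) ->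
  mlim u L.
Proof.
move=> uRe uIm.
pose h i j n := `|complex.Re (u n i j) - complex.Re (L i j)|
                + `|complex.Im (u n i j) - complex.Im (L i j)|.
have h_ge0 i j n : 0 <= h i j n by exact: addr_ge0.
have h_cvg0 i j : h i j n @[n --> \oo] --> (0 : R).
  rewrite -[X in _ --> X]addr0; apply: cvgD; apply/norm_cvg0P.
    by rewrite -(subrr (complex.Re (L i j))); apply: cvgB; [exact: uRe|exact: cvg_cst].
  by rewrite -(subrr (complex.Im (L i j))); apply: cvgB; [exact: uIm|exact: cvg_cst].
apply: (@mlim_squeeze _ _ (fun n => \sum_(i < 2) \sum_(j < 2) h i j n)).
  move=> n; apply: rownorm_le => [|i].
    by apply: sumr_ge0 => i _; apply: sumr_ge0.
  rewrite [leRHS](bigD1 i)//=; apply: ler_wpDr.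
    by apply: sumr_ge0 => k _; apply: sumr_ge0.
  apply: ler_sum => j _; apply: le_trans (cabs_le_ReIm _) _.
  by rewrite !mxE /h; case: (u n i j) => x y; case: (L i j).
have sum_cvg0 (f : 'I_2 -> nat -> R) :
    (forall i, f i n @[n --> \oo] --> (0 : R)) ->
    \sum_(i < 2) f i n @[n --> \oo] --> (0 : R).
  move=> f0; have -> : (fun n => \sum_(i < 2) f i n) =
      (fun n => f ord0 n + f (lift ord0 ord0) n).
    by apply/funext => n; rewrite big_ord_recl big_ord1.
  by rewrite -[X in _ --> X]addr0; exact: cvgD (f0 _) (f0 _).
by apply: (sum_cvg0 (fun i n => \sum_j h i j n)) => i; exact: sum_cvg0.
Qed.

End MatrixLimits.

(** * The matrix exponential: convergence, Lipschitz bound, functional equation, conjugation *)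

Section MatrixExponential.
Variable R : realType.
Local Notation M2 := 'M[R[i]]_2.
Implicit Types (M W V : M2) (c : R).

Lemma cvg_expR (x : R) : series (exp_coeff x) n @[n --> \oo] --> expR x.
Proof. exact: is_cvg_series_exp_coeff. Qed.

Lemma expsumR (x : R) n : expsum (x : R^o) n = series (exp_coeff x) n.
Proof.
by rewrite /expsum /series /= big_mkord; apply: eq_bigr => k _; exact: mulrC.
Qed.

Lemma mexp_partialE M n : mexp_partial M n = expsum M n.
Proof. by []. Qed.

Lemma rownorm_expterm M k :
  rownorm ((k`!%:R)^-1 *: M ^+ k) <= exp_coeff (rownorm M) k.
Proof.
apply: le_trans (rownormZ _ _) _; rewrite cabs_invfact /exp_coeff /= mulrC.
by rewrite ler_wpM2r ?invr_ge0// rownormX.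
Qed.

(** Meant for [g] the real or the imaginary part. Additivity makes the sequence a series, dominated
    by the exponential series at [rownorm M], hence absolutely convergent. *)
Lemma is_cvg_mexp_partial (g : R[i] -> R) M i j : g 0 = 0 ->
  {morph g : x y / x + y} -> (forall z, `|g z| <= cabs z) ->
  cvgn (fun n => g (mexp_partial M n i j)).
Proof.
move=> g0 gD gle.
have -> : (fun n => g (mexp_partial M n i j)) =
    series (fun k => g (((k`!%:R)^-1 *: M ^+ k) i j)).
  apply/funext => n; rewrite /series /= big_mkord /mexp_partial summxE.
  by rewrite (big_morph g gD g0).
apply: normed_cvg.
apply: series_le_cvg (is_cvg_series_exp_coeff (rownorm M)) => n;
  [exact: normr_ge0|exact/exp_coeff_ge0/rownorm_ge0|].
exact: le_trans (gle _) (le_trans (entry_le_rownorm _ _ _) (rownorm_expterm _ _)).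
Qed.

Lemma mexp_cvg M : mlim (mexp_partial M) (mexp M).
Proof.
apply: mlim_entrywise => i j; rewrite mxE /=.
  rewrite mul0r mul1r !(subr0, addr0, add0r, oppr0).
  apply: (@is_cvg_mexp_partial (@complex.Re R)) => //; last exact: normr_Re_le.
  by case=> ? ? [].
rewrite mul0r mul1r !(subr0, addr0, add0r, oppr0).
apply: (@is_cvg_mexp_partial (@complex.Im R)) => //; last exact: normr_Im_le.
by case=> ? ? [].
Qed.

Lemma rownorm_mexp M : rownorm (mexp M) <= expR (rownorm M).
Proof.
apply: (mlim_le (mexp_cvg M) _ (@cvg_expR _)) => n.
rewrite /series /= big_mkord; apply: le_trans (rownorm_sum _ _ _) _.
by apply: ler_sum => k _; exact: rownorm_expterm.
Qed.

(** Termwise, [rownorm_subX] leaves [(k + 1) c^k / (k + 1)! = c^k / k!] times [rownorm (M - W)];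
    summing over [k] gives [expR c]. *)
Lemma rownorm_mexpB M W c : rownorm M <= c -> rownorm W <= c ->
  rownorm (mexp M - mexp W) <= rownorm (M - W) * expR c.
Proof.
move=> Mc Wc; have c0 : 0 <= c by exact: le_trans (rownorm_ge0 _) Mc.
have cvg : rownorm (M - W) * series (exp_coeff c) n @[n --> \oo]
    --> rownorm (M - W) * expR c by apply: cvgM; [exact: cvg_cst|exact: cvg_expR].
apply: (mlim_le (mlimB (mexp_cvg M) (mexp_cvg W)) _ cvg) => -[|n].
  by rewrite /mexp_partial !big_ord0 subrr rownorm0 mulr_ge0 ?rownorm_ge0// /series /= big_nil.
(* The degree 0 terms of the two exponentials cancel, so [n.+1] terms leave [n] differences; the
   last term of the majorant, being nonnegative, is dropped to match. *)
rewrite /series /= big_nat_recr //= mulrDr ler_wpDr//.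
  by rewrite mulr_ge0 ?rownorm_ge0 ?exp_coeff_ge0.
rewrite /mexp_partial -sumrB big_ord_recl subrr add0r big_mkord mulr_sumr.
apply: le_trans (rownorm_sum _ _ _) _; apply: ler_sum => k _.
rewrite -scalerBr; apply: le_trans (rownormZ _ _) _; rewrite cabs_invfact.
apply: le_trans (ler_wpM2l _ (rownorm_subX k Mc Wc)) _; first by rewrite invr_ge0.
rewrite /exp_coeff /= factS natrM le_eqVlt; apply/orP; left; apply/eqP.
have f0 : (k`!%:R : R) != 0 by rewrite pnatr_eq0 -lt0n fact_gt0.
have k0 : (k.+1%:R : R) != 0 by rewrite pnatr_eq0.
by field; rewrite f0 nat1r k0.
Qed.

Lemma mexp0 : mexp (0 : M2) = 1.
Proof.
apply: (mlim_unique (mexp_cvg 0)); apply: cvg_near_cst.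
(* The empty partial sum is 0, so the sequence is constantly 1 only from index 1 on. *)
exists 1%N => // -[//|n] _ /=.
rewrite /mexp_partial big_ord_recl expr0 invr1 scale1r big1 ?addr0 ?subrr ?rownorm0//.
by move=> k _; rewrite exprS mul0r scaler0.
Qed.

(* The Cauchy-product defect of the partial sums is dominated termwise by that
   of the real exponential series at the norms, which vanishes in the limit. *)
Lemma mexpD M W : GRing.comm M W -> mexp (M + W) = mexp M * mexp W.
Proof.
move=> cMW; apply/esym/subr0_eq/rownorm_eq0.
pose m := rownorm M; pose w := rownorm W.
pose defect n := series (exp_coeff m) n * series (exp_coeff w) n
                 - series (exp_coeff (m + w)) n.
have defect0 : defect n @[n --> \oo] --> (0 : R).
  rewrite -(subrr (expR (m + w))) {1}expRD.
  by apply: cvgB; [apply: cvgM|]; exact: cvg_expR.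
apply: (mlim_le (mlimB (mlimM (mexp_cvg M) (mexp_cvg W)) (mexp_cvg (M + W)))
  _ defect0) => n.
rewrite !mexp_partialE expsum_mul_sub// /defect -!expsumR.
rewrite (@expsum_mul_sub _ R^o); last exact: mulrC.
apply: le_trans (rownorm_sum _ _ _) _; apply: ler_sum => j _.
apply: le_trans (rownorm_sum _ _ _) _; apply: ler_sum => i _.
apply: le_trans (rownormZ _ _) _; rewrite cabsM !cabs_invfact.
apply: ler_wpM2l; first by rewrite mulr_ge0 ?invr_ge0.
apply: le_trans (rownormM _ _) _.
by apply: ler_pM; rewrite ?rownorm_ge0 ?rownormX.
Qed.

(** Conjugation commutes with powers, hence with partial sums, and multiplication by fixed matrices
    passes to the limit. *)
Lemma mexp_conj V W M : V * W = 1 -> V * mexp M * W = mexp (V * M * W).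
Proof.
move=> VW1; have WV1 : W * V = 1 by exact: mulmx1C.
have := mlimM (mlimM (mlim_cst V) (mexp_cvg M)) (mlim_cst W).
move=> /mlim_unique; apply.
suff -> : (fun n => V * mexp_partial M n * W) = mexp_partial (V * M * W).
  exact: mexp_cvg.
apply/funext => n; rewrite /mexp_partial mulr_sumr mulr_suml.
apply: eq_bigr => k _; rewrite -scalerAr -scalerAl; congr (_ *: _).
elim: (k : nat) => [|l IHl]; first by rewrite !expr0 mulr1.
by rewrite !exprS -IHl !mulrA -(mulrA (V * M)) WV1 mulr1.
Qed.

End MatrixExponential.

(** * The flow of [thetam] as rotations, and the explicit form of [Ym] *)

Section Generators.
Variable R : realType.
Local Notation M2 := 'M[R[i]]_2.

Lemma ord2P (P : 'I_2 -> Prop) : P 0 -> P 1 -> forall i, P i.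
Proof.
move=> P0 P1 [[|[|//]] lt]; first by rewrite (_ : Ordinal lt = 0)//; exact/val_inj.
by rewrite (_ : Ordinal lt = 1)//; exact/val_inj.
Qed.

Lemma sum2E (V : nmodType) (f : 'I_2 -> V) : \sum_i f i = f 0 + f 1.
Proof. by rewrite big_ord_recl big_ord1; congr (_ + f _); exact/val_inj. Qed.

(** The matrix of multiplication by [c + i s] on the plane; a rotation when [c] and [s] are the
    cosine and sine of an angle. *)
Definition cosinmx (c s : R) : M2 :=
  \matrix_(i, j) (if i == j then c else if i == 0 then - s else s)%:C.

Lemma cosinmxM (c s c' s' : R) :
  cosinmx c s * cosinmx c' s' = cosinmx (c * c' - s * s') (c * s' + s * c').
Proof.
apply/matrixP; apply: ord2P; apply: ord2P; rewrite !mxE sum2E !mxE /=;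
  by rewrite -!rmorphM -rmorphD; congr (_%:C); ring.
Qed.

(** The matrix [t%:C *: thetam R] is [cosinmx 0 (t / 2)], whose square is the scalar [- (t / 2)^2].
    Even powers therefore feed the cosine series and odd powers the sine series. *)
Lemma thetamXE (t : R) k :
  (k`!%:R)^-1 *: (t%:C *: thetam R) ^+ k =
  cosinmx (cos_coeff (t / 2) k) (sin_coeff (t / 2) k).
Proof.
have tE : t%:C *: thetam R = cosinmx 0 (t / 2).
  apply/matrixP; apply: ord2P; apply: ord2P; rewrite !mxE /= ?mulr0// -rmorphM;
    by congr (_%:C); ring.
have -> : (t%:C *: thetam R) ^+ k =
    cosinmx ((~~ odd k)%:R * (-1) ^+ k./2 * (t / 2) ^+ k)
            ((odd k)%:R * (-1) ^+ k.-1./2 * (t / 2) ^+ k).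
  rewrite tE; elim: k => [|k IHk].
    rewrite /= !expr0 !mulr1; apply/matrixP => i j; rewrite !mxE oppr0.
    by rewrite if_same; case: eqP.
  rewrite exprSr IHk cosinmxM !mulr0 add0r addr0 /= uphalf_half exprSr.
  congr cosinmx; last by rewrite !mulrA.
  case: k {IHk} => [|k] /=; first by rewrite !mul0r oppr0.
  by rewrite negbK uphalf_half; case: (odd k) => /=; rewrite ?add0n ?add1n ?exprS; ring.
apply/matrixP => i j; rewrite !mxE -(rmorph_nat (real_complex R)) -fmorphV -rmorphM.
rewrite /cos_coeff /sin_coeff /=; congr (_%:C).
by case: ifP => _; [|case: ifP => _]; rewrite ?mulrN mulrC.
Qed.

Lemma mflow_thetam (t : R) :
  mflow (thetam R) t%:C = cosinmx (cos (t / 2)) (sin (t / 2)).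
Proof.
have E n : mexp_partial (t%:C *: thetam R) n =
    cosinmx (series (cos_coeff (t / 2)) n) (series (sin_coeff (t / 2)) n).
  rewrite /series /= !big_mkord /mexp_partial.
  under eq_bigr do rewrite thetamXE.
  apply/matrixP => i j; rewrite summxE !mxE.
  under eq_bigr do rewrite mxE.
  rewrite -rmorph_sum; case: eqP => // _; case: eqP => // _; congr (_%:C).
  by rewrite sumrN.
have cvgc : series (cos_coeff (t / 2)) n @[n --> \oo] --> cos (t / 2).
  by rewrite unlock; exact: is_cvg_series_cos_coeff.
have cvgs : series (sin_coeff (t / 2)) n @[n --> \oo] --> sin (t / 2).
  by rewrite unlock; exact: is_cvg_series_sin_coeff.
apply: (mlim_unique (mexp_cvg _)); apply: mlim_entrywise => i j.
  rewrite (_ : (fun n => _) = fun n => if i == j then series (cos_coeff (t / 2)) n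
    else if i == 0 then - series (sin_coeff (t / 2)) n else series (sin_coeff (t / 2)) n).
    by rewrite mxE; case: eqP => // _; case: eqP => // _; exact: cvgN.
  by apply/funext => n; rewrite E mxE.
by rewrite mxE /=; under eq_cvg do rewrite E mxE /=; exact: cvg_cst.
Qed.

(** Conjugating by the rotation of angle [x = pi / 4] gives diagonal entries [(cos^2 - sin^2) / 2]
    up to sign and off-diagonal entries [cos x * sin x]. Their values come from the cosine and sine
    of the doubled angle [pi / 2]. *)
Lemma YmE : Ym R = \matrix_(i, j) (if i == j then 0 else (1 / 2)%:C).
Proof.
rewrite /Ym !mflow_thetam mulNr cosN sinN.
set x := pi / 2 / 2.
have cs : cos x * cos x = sin x * sin x.
  by apply/subr0_eq; rewrite -cosD /x -splitr cos_pihalf.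
have sc : cos x * sin x *+ 2 = 1.
  by rewrite -sin_mulr2n mulr2n /x -splitr sin_pihalf.
apply/matrixP; apply: ord2P; apply: ord2P;
  rewrite !mxE !sum2E !mxE !sum2E !mxE /=; apply/eqP; rewrite eq_complex /=;
  apply/andP; split; apply/eqP; nra.
Qed.

Lemma rownorm_Xm : rownorm (Xm R) <= 1 / 2.
Proof.
apply: rownorm_le; first lra.
by apply: ord2P; rewrite sum2E !mxE /= cabs0 cabs_real ?normrN ger0_norm; lra.
Qed.

Lemma rownorm_Ym : rownorm (Ym R) <= 1 / 2.
Proof.
rewrite YmE; apply: rownorm_le; first lra.
by apply: ord2P; rewrite sum2E !mxE /= cabs0 cabs_real ?normrN ger0_norm; lra.
Qed.

Lemma mflow_mulN (U : M2) (t : R[i]) : mflow U t * mflow U (- t) = 1.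
Proof.
by rewrite /mflow -mexpD; [rewrite scaleNr subrr mexp0|rewrite scaleNr; exact/commrN/commr_refl].
Qed.

End Generators.

(** * Conjugates of [Xm] under the flow of [Ym] *)

Section Conjugates.
Variable R : realType.
Implicit Types a b : R[i].

(** The matrix [Z(b)] of the overview. *)
Definition conjX b : 'M[R[i]]_2 := mflow (Ym R) b * Xm R * mflow (Ym R) (- b).

Lemma mflow_conjE a b :
  mflow (Ym R) b *m mflow (Xm R) a *m mflow (Ym R) (- b) = mexp (a *: conjX b).
Proof.
have := mexp_conj (a *: Xm R) (mflow_mulN (Ym R) b).
by rewrite -scalerAr -scalerAl.
Qed.

Lemma rownorm_scaleYm b : rownorm (b *: Ym R) <= cabs b / 2.
Proof.
apply: le_trans (rownormZ _ _) _.
by rewrite ler_wpM2l ?cabs_ge0// -[2^-1]mul1r rownorm_Ym.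
Qed.

Lemma rownorm_mflowYm b : rownorm (mflow (Ym R) b) <= expR (cabs b / 2).
Proof.
apply: le_trans (rownorm_mexp _) _.
by rewrite ler_expR rownorm_scaleYm.
Qed.

Lemma rownorm_mflowYmB b b' (c : R) : cabs b <= c -> cabs b' <= c ->
  rownorm (mflow (Ym R) b - mflow (Ym R) b') <= cabs (b - b') / 2 * expR (c / 2).
Proof.
move=> bc b'c; apply: (@le_trans _ _ (rownorm (b *: Ym R - b' *: Ym R) * expR (c / 2))).
  apply: rownorm_mexpB; (apply: le_trans (rownorm_scaleYm _) _); lra.
by rewrite -scalerBl ler_wpM2r ?expR_ge0 ?rownorm_scaleYm.
Qed.

Lemma expR_half (c : R) : expR (c / 2) * expR (c / 2) = expR c.
Proof. by rewrite -expRD -splitr. Qed.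

Lemma rownormM3 (U V W : 'M[R[i]]_2) (u v w : R) :
  rownorm U <= u -> rownorm V <= v -> rownorm W <= w ->
  rownorm (U * V * W) <= u * v * w.
Proof.
move=> Uu Vv Ww; apply: le_trans (rownormM _ _) _.
apply: ler_pM; rewrite ?rownorm_ge0//.
by apply: le_trans (rownormM _ _) _; apply: ler_pM; rewrite ?rownorm_ge0.
Qed.

(** Each flow contributes [expR (cabs b / 2)] and [Xm] contributes [1 / 2]. *)
Lemma rownorm_conjX b : rownorm (conjX b) <= expR (cabs b) / 2.
Proof.
have -> : expR (cabs b) / 2 = expR (cabs b / 2) * (1 / 2) * expR (cabs (- b) / 2).
  by rewrite cabsN -[expR (cabs b)]expR_half; ring.
apply: rownormM3; [exact: rownorm_mflowYm|exact: rownorm_Xm|exact: rownorm_mflowYm].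
Qed.

Lemma subrM3 (S : pzRingType) (p q x r s : S) :
  p * x * r - q * x * s = (p - q) * x * r + q * x * (r - s).
Proof. by rewrite !mulrBl mulrBr addrA subrK. Qed.

(** Changing one flow factor at a time leaves two errors, each at most
    [cabs (b - b') / 4 * expR c]. *)
Lemma rownorm_conjXB b b' (c : R) : cabs b <= c -> cabs b' <= c ->
  rownorm (conjX b - conjX b') <= cabs (b - b') / 2 * expR c.
Proof.
move=> bc b'c.
pose Y := mflow (Ym R).
have -> : conjX b - conjX b' =
    (Y b - Y b') * Xm R * Y (- b) + Y b' * Xm R * (Y (- b) - Y (- b')).
  exact: subrM3.
have Yc z : cabs z <= c -> rownorm (Y z) <= expR (c / 2).
  move=> zc; apply: le_trans (rownorm_mflowYm _) _; rewrite ler_expR; lra.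
have dN : cabs (- b - - b') = cabs (b - b') by rewrite -opprD cabsN.
pose d := cabs (b - b').
have -> : d / 2 * expR c =
    d / 2 * expR (c / 2) * (1 / 2) * expR (c / 2)
    + expR (c / 2) * (1 / 2) * (d / 2 * expR (c / 2)).
  by rewrite -[expR c]expR_half; field.
apply: le_trans (rownormD _ _) (lerD _ _); apply: rownormM3;
  rewrite ?rownorm_Xm ?rownorm_mflowYmB ?Yc ?cabsN//.
by rewrite /d -dN rownorm_mflowYmB ?cabsN.
Qed.

(** * Perturbation of a single exponent [a Z(b)] *)

Section Perturbation.
Variables (a b a' b' : R[i]) (eps : R).
Hypotheses (eps_gt0 : 0 < eps) (eps_lt : eps < 1 / 2).
Hypotheses (bb' : cabs (b - b') < eps) (aa' : cabs (a - a') < eps * cabs a).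
Let m := cabs a * expR (cabs b).

Let m_ge0 : 0 <= m.
Proof. by rewrite mulr_ge0 ?cabs_ge0 ?expR_ge0. Qed.

Let cabs_a'_le : cabs a' <= (1 + eps) * cabs a.
Proof.
rewrite -[a'](subKr a); apply: le_trans (cabsD _ _) _.
by rewrite cabsN mulrDl mul1r lerD2l ltW.
Qed.

Let cabs_b'_le : cabs b' <= cabs b + eps.
Proof.
rewrite -[b'](subKr b); apply: le_trans (cabsD _ _) _.
by rewrite cabsN lerD2l ltW.
Qed.

(** From [1 - eps <= expR (- eps)] one gets [expR eps <= 1 / (1 - eps) < 2], as [eps < 1 / 2]. *)
Let expR_b_eps : expR (cabs b + eps) <= 2 * expR (cabs b).
Proof.
rewrite expRD mulrC ler_wpM2r ?expR_ge0//.
have e0 : 0 < expR eps by exact: expR_gt0.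
have := expR_ge1Dx (- eps); rewrite expRN => h.
have := ler_wpM2r (ltW e0) h; rewrite mulVf ?lt0r_neq0// => h'.
move: eps_lt => ?; nra.
Qed.

Lemma rownorm_scale_conjX : rownorm (a *: conjX b) <= 2 * m.
Proof.
apply: le_trans (rownormZ _ _) _.
apply: le_trans (ler_wpM2l (cabs_ge0 _) (rownorm_conjX _)) _.
rewrite mulrA -/m; move: m_ge0 => ?; lra.
Qed.

(** Here [rownorm (conjX b') <= expR (cabs b + eps) / 2 <= expR (cabs b)] and [1 + eps <= 2]. The
    bound uses the unperturbed [m], so both exponents share one majorant. *)
Lemma rownorm_scale_conjX' : rownorm (a' *: conjX b') <= 2 * m.
Proof.
apply: le_trans (rownormZ _ _) _.
have a0 := cabs_ge0 a.
apply: (@le_trans _ _ ((1 + eps) * cabs a * expR (cabs b))).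
  apply: ler_pM; rewrite ?cabs_ge0 ?rownorm_ge0//.
  apply: le_trans (rownorm_conjX _) _.
  rewrite ler_pdivrMr// mulrC; apply: le_trans expR_b_eps.
  by rewrite ler_expR.
rewrite -mulrA -/m; move: m_ge0 eps_lt => ? ?; nra.
Qed.

(** Changing [a] costs [eps * m / 2] and changing [b] costs [(1 + eps) * eps * m]; for [eps < 1 / 2]
    the total is at most [2 * eps * m]. *)
Lemma rownorm_scale_conjXB :
  rownorm (a *: conjX b - a' *: conjX b') <= 2 * eps * m.
Proof.
have -> : a *: conjX b - a' *: conjX b' =
    (a - a') *: conjX b + a' *: (conjX b - conjX b').
  by rewrite scalerBl scalerBr addrA subrK.
apply: le_trans (rownormD _ _) _.
have a0 := cabs_ge0 a.
apply: (@le_trans _ _ (eps * cabs a * (expR (cabs b) / 2)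
   + (1 + eps) * cabs a * (eps * expR (cabs b)))).
  apply: lerD; apply: le_trans (rownormZ _ _) _.
    by apply: ler_pM; rewrite ?cabs_ge0 ?rownorm_ge0 ?rownorm_conjX// ltW.
  apply: ler_pM; rewrite ?cabs_ge0 ?rownorm_ge0//.
  (* The radius [cabs b + eps] covers both [b] and [b']; returning to [cabs b] costs a factor 2,
     absorbed by the halved distance. *)
  apply: (@le_trans _ _ (cabs (b - b') / 2 * expR (cabs b + eps))).
    by apply: rownorm_conjXB; rewrite ?lerDl// ltW.
  have -> : eps * expR (cabs b) = eps / 2 * (2 * expR (cabs b)) by field.
  apply: ler_pM; rewrite ?expR_ge0// ?divr_ge0 ?cabs_ge0//.
  by rewrite ler_wpM2r ?invr_ge0// ltW.
have -> : eps * cabs a * (expR (cabs b) / 2) = eps * m / 2 by rewrite /m; ring.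
have -> : (1 + eps) * cabs a * (eps * expR (cabs b)) = (1 + eps) * (eps * m).
  by rewrite /m; ring.
have : 0 <= eps * m by rewrite mulr_ge0// ltW.
move: eps_lt => ? ?; nra.
Qed.

End Perturbation.

End Conjugates.

(** * Assembly of the product estimate *)

Unset Implicit Arguments.

Theorem theoremA1 (R : realType) (n : nat) (a b a' b' : 'I_n -> R[i])
    (A B eps : R) (hA : 0 < A) (hB : 0 < B) (heps : 0 < eps)
    (hepsA : eps < A^-1) (hepse : eps < (expR 1)^-1)
    (hsum : \sum_(i < n) cabs (a i) * expR (cabs (b i)) <= B)
    (h1 : forall i, 2 * cabs (a i) * expR (cabs (b i) + 1) <= A)
    (h2 : forall i, cabs (b i - b' i) < eps)
    (h3 : forall i, cabs (a i - a' i) < eps * cabs (a i)) :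
  opnorm (\prod_(i < n) (mflow (Ym R) (b i) *m mflow (Xm R) (a i) *m mflow (Ym R) (- b i))
          - \prod_(i < n) (mflow (Ym R) (b' i) *m mflow (Xm R) (a' i) *m mflow (Ym R) (- b' i)))
  <= 12 * expR (A + 2 * B) * B * eps.
Proof.
(* Since [e >= 1 + 1], the bound [1 / e] on [eps] gives the threshold of the perturbation
   estimates. *)
have eps_lt : eps < 1 / 2.
  apply: lt_le_trans hepse _; rewrite mul1r lef_pV2 ?posrE ?expR_gt0//.
  by have := expR_ge1Dx (1 : R); rewrite -[1 + 1]/2.
pose m i := cabs (a i) * expR (cabs (b i)).
have Mm i : rownorm (a i *: conjX (b i)) <= 2 * m i by exact: rownorm_scale_conjX.
have M'm i : rownorm (a' i *: conjX (b' i)) <= 2 * m i.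
  exact: (rownorm_scale_conjX' eps_lt (h2 i) (h3 i)).
apply: le_trans (opnorm_le_rownorm _) _.
apply: (@le_trans _ _ (2 * rownorm (\prod_(i < n) mexp (a i *: conjX (b i))
                                    - \prod_(i < n) mexp (a' i *: conjX (b' i))))).
  rewrite le_eqVlt; apply/orP; left; apply/eqP.
  by congr (2 * rownorm (_ - _)); apply: eq_bigr => i _; exact: mflow_conjE.
have key := @rownorm_subprod R _ (index_enum 'I_n)
  (fun i => mexp (a i *: conjX (b i))) (fun i => mexp (a' i *: conjX (b' i)))
  (fun i => 2 * m i) (fun i => 2 * eps * m i).
apply: le_trans (ler_wpM2l _ (key _ _ _)) _ => //.
- by move=> i; apply: le_trans (rownorm_mexp _) _; rewrite ler_expR.
- by move=> i; apply: le_trans (rownorm_mexp _) _; rewrite ler_expR.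
- move=> i; apply: le_trans (rownorm_mexpB (Mm i) (M'm i)) _.
  rewrite ler_wpM2r ?expR_ge0//.
  exact: (rownorm_scale_conjXB heps eps_lt (h2 i) (h3 i)).
rewrite -!mulr_sumr; set S := \sum_i m i.
have S0 : 0 <= S by apply: sumr_ge0 => i _; rewrite mulr_ge0 ?cabs_ge0 ?expR_ge0.
(* One factor 2 comes from the norm comparison, the other from the distance of the exponents. Then
   [4 <= 12] and [2 * S <= 2 * B <= A + 2 * B], as [A] is positive. *)
have -> : 2 * (2 * eps * S * expR (2 * S)) = 4 * expR (2 * S) * S * eps by ring.
apply: ler_wpM2r; first exact: ltW.
apply: ler_pM => //.
apply: ler_pM; rewrite ?expR_ge0 ?ler_nat// ler_expR.
have SB : S <= B by [].
lra.
Qed.
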